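(* For each integer $N \geq 5$, let $$ M(N) = \begin{cases} 2N+3, & \text{if } N \equiv -1 \bmod 12,\\ 2N+1, & \text{if } N \equiv 0, 1, 3, 5, 7, \text{ or } 9 \bmod 12,\\ 2N, & \text{if } N \equiv 2, 4, 6, 8, \text{ or } 10 \bmod 12. \end{cases} $$ Then for each integer $N\ge 5$ there exist $N$ distinct parallel lines $l_1,\dots,l_N$ in the plane and $M=M(N)$ distinct lines $\lambda_1,\dots,\lambda_M$, none of them parallel to the $l_i$, such that for each $i\in\{1,\dots,N\}$ $$\#\Bigl(\bigcup_{j=1}^{M} l_i\cap\lambda_j\Bigr)\le N .$$ Moreover, if $N=12m$ for a positive integer $m$, then there exist $N$ distinct parallel lines $l_1,\dots,l_N$ and $2N+1$ distinct lines $\lambda_1,\dots,\lambda_{2N+1}$, none of them parallel to the $l_i$, such that $\#\bigl(\bigcup_{j} l_i\cap\lambda_j\bigr)= N-1$ for each $i$.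
   Context: All lines are in the real plane $\mathbf{R}^2$. The quantity $\#\bigl(\bigcup_j l_i\cap\lambda_j\bigr)$ is the number of distinct points of $l_i$ through which at least one of the lines $\lambda_j$ passes. *)

(* Defs.v *)
From HB Require Import structures.
From mathcomp Require Import all_boot all_order all_algebra.
From mathcomp Require Import all_classical all_reals.

Set Implicit Arguments.
Unset Strict Implicit.
Unset Printing Implicit Defensive.

Import Order.TTheory GRing.Theory Num.Theory.

Local Open Scope classical_set_scope.
Local Open Scope ring_scope.

Definition is_line (R : realType) (L : set (R * R)) : Prop :=
  exists a b c : R, (a, b) <> (0, 0) /\
    L = [set p : R * R | a * p.1 + b * p.2 = c].

(* A line counts as parallel to itself. *)
Definition parallel (R : realType) (L1 L2 : set (R * R)) : Prop :=
  L1 = L2 \/ L1 `&` L2 = set0.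

Definition lines_config (R : realType) (N M : nat)
    (l : 'I_N -> set (R * R)) (lambda : 'I_M -> set (R * R)) : Prop :=
  [/\ injective l /\ (forall i, is_line (l i)),
      forall i k, parallel (l i) (l k),
      injective lambda /\ (forall j, is_line (lambda j)) &
      forall i j, ~ parallel (lambda j) (l i)].

(* The residues 2, 4, 6, 8, 10 modulo 12 are those left to the last branch. *)
Definition num_lines (N : nat) : nat :=
  if N.+1 == 0 %[mod 12] then (2 * N + 3)%N
  else if (N %% 12)%N \in [:: 0; 1; 3; 5; 7; 9]%N then (2 * N + 1)%N
  else (2 * N)%N.

(* Main.v *)
Require Import Defs.
From HB Require Import structures.
From mathcomp Require Import all_boot all_order all_algebra.
From mathcomp Require Import all_classical all_reals.
From mathcomp Require Import trigo.
From mathcomp Require Import zify ring lra.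

Set Implicit Arguments.
Unset Strict Implicit.
Unset Printing Implicit Defensive.

Import Order.TTheory GRing.Theory Num.Theory.

Local Open Scope classical_set_scope.
Local Open Scope ring_scope.

(** Let lambda be the graph of x + s y as a function of s, and let l be the
vertical line of abscissa t.  They meet at height x + t y, so that the
crossings on l are counted by the values which one linear form takes at the
points (x, y).  Up to a scalar that form is the orthogonal projection to a
direction determined by t.  The theorem therefore asks for M points in the
plane and N directions along each of which the points have at most N distinct
projections; [polar_config] is this translation, for points given in polar
coordinates.  Put u = pi / n, use points whose arguments are multiples of u
and directions s u with s < n.  The projection of such a point is its radius
times some cos (k u), where k can be taken in [0, n] ([cos_fold]).

For most N, take n = 2 N and the vertices of a regular 2N-gon (arguments 2 j u),
with the odd multiples of u as directions, the normals to the edges.  Only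
the odd k in [0, 2 N] occur, hence N projections.  If N is odd, then
cos (N u) = 0 is among them, and the center comes for free.

For N = 12 m, take n = N and three orbits: the regular n-gon of radius 1, the
n-gon of radius r = 2 cos ((6 m - 1) u) = 2 sin (pi / n) rotated by u (its
vertices are the edge vectors of the first n-gon), and the center.  In the
direction s u the first n-gon contributes cos (k u) for k of the parity of s,
the second one r cos (k u) for the other k in [0, n], and the center
contributes 0, which is the term k = 6 m.  So there are at most n + 1 values,
and two coincidences of opposite sign lower this to n - 1:
r cos u = sin (2 pi / n) if s is even, and r cos (pi / 3) = sin (pi / n) if s
is odd.  Nothing else coincides ([collision]), because r is so small that
the short orbit only reaches the values of the long one that are closest to 0.
A subset of the directions keeps the count n - 1, and omitting one of them
settles N = 12 m - 1. *)

(** * Cardinality of a duplicate-free sequence *)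

Lemma card_uniq_seq (T : choiceType) (x0 : T) (s : seq T) :
  uniq s -> ([set` s] #= `I_(size s))%card.
Proof.
move=> us.
have -> : [set` s] = nth x0 s @` `I_(size s).
  apply/seteqP; split=> [x /= /nthP - /(_ x0)[i ilt <-]|x [i /= ilt <-]].
    by exists i.
  exact: mem_nth.
apply: inj_card_eq => i j; rewrite !inE => ilt jlt e.
by apply/eqP; rewrite -(nth_uniq x0 ilt jlt us) e.
Qed.

(** * Trigonometric facts *)

Section Trigonometry.
Variable R : realType.
Implicit Types x y : R.

Lemma sin_eq0_small x : `|x| < pi -> sin x = 0 -> x = 0.
Proof.
move=> xpi sx; have [xlt|xgt|//] := ltgtP x 0.
- have := @sin_gt0_pi R (- x); rewrite sinN sx oppr0 ltxx => H.
  by suff: false by []; apply: H; move: xpi; rewrite ltr0_norm //; lra.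
- have := @sin_gt0_pi R x; rewrite sx ltxx => H.
  by suff: false by []; apply: H; move: xpi; rewrite gtr0_norm //; lra.
Qed.

Lemma cos_eq1_small x : `|x| < 2 * pi -> cos x = 1 -> x = 0.
Proof.
move=> xpi cx.
have : sin (x / 2) = 0.
  have := cos_mulr2n (x / 2); have := cos2Dsin2 (x / 2).
  rewrite (_ : (x / 2) *+ 2 = x); last by rewrite mulr2n; field.
  rewrite cx mulr2n => e1 e2; apply/eqP; rewrite -sqrf_eq0; apply/eqP; lra.
move/sin_eq0_small => H; have : x / 2 = 0; last by lra.
by apply: H; rewrite normrM (@ger0_norm _ 2^-1) //; lra.
Qed.

(** cos (3 x) = -1 factors as (cos x + 1) (2 cos x - 1) ^ 2 = 0. *)
Lemma cos_pi3 : cos (pi / 3 : R) = 2^-1.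
Proof.
set x : R := pi / 3; have p0 := pi_gt0 R.
have c0 : 0 < cos x by apply: cos_gt0_pihalf; rewrite /x; lra.
have e2 := cos_mulr2n x; have s2 := sin_mulr2n x; have := cos2Dsin2 x.
have e3 : cos (x *+ 2 + x) = -1.
  by rewrite -cospi; congr cos; rewrite /x mulr2n; field.
rewrite cosD e2 s2 !mulr2n in e3 => e1.
have : (cos x + 1) * (2 * cos x - 1) ^+ 2 = 0.
  move: e1 e3; set c := cos x; set s := sin x => e1 e3.
  transitivity ((c ^+ 2 + c ^+ 2 - 1) * c - (c * s + c * s) * s + 1 +
    2 * c * (c ^+ 2 + s ^+ 2 - 1)); first by ring.
  by rewrite e3 e1; ring.
by move/eqP; rewrite mulf_eq0 sqrf_eq0 => /orP[] /eqP e; lra.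
Qed.

End Trigonometry.

(** * Vertical lines and graphs of affine functions *)

Lemma parallel_vertical (R : realType) (t t' : R) :
  parallel [set q : R * R | q.1 = t] [set q | q.1 = t'].
Proof.
have [->|tt] := eqVneq t t'; first by left.
by right; apply/seteqP; split=> // q [/= -> /eqP]; rewrite (negbTE tt).
Qed.

Lemma lines_config_graphs (R : realType) L M
    (t : 'I_L -> R) (x y : 'I_M -> R) :
  injective t -> injective (fun j => (x j, y j)) ->
  lines_config (fun i => [set q : R * R | q.1 = t i])
               (fun j => [set q : R * R | q.2 = x j + q.1 * y j]).
Proof.
move=> tI xyI; split.
- split=> [i k e|i].
    apply: tI; have : [set q : R * R | q.1 = t i] (t i, 0) by [].
    by rewrite e.
  exists 1, 0, (t i); split; first by case=> /eqP; rewrite oner_eq0.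
  by apply/seteqP; split=> q /=; lra.
- by move=> i k; exact: parallel_vertical.
- split=> [j k e|j].
    have at_ s : x j + s * y j = x k + s * y k.
      have : [set q : R * R | q.2 = x j + q.1 * y j] (s, x j + s * y j) by [].
      by rewrite e.
    by apply: xyI; have a0 := at_ 0; have a1 := at_ 1; congr (_, _); lra.
  exists (- y j), 1, (x j); split; first by case=> _ /eqP; rewrite oner_eq0.
  by apply/seteqP; split=> q /=; lra.
- move=> i j [e|e].
    have : [set q : R * R | q.2 = x j + q.1 * y j] (t i + 1, x j + (t i + 1) * y j).
      by [].
    rewrite e /=; lra.
  have : set0 (t i, x j + t i * y j) by rewrite -e.
  by [].
Qed.

Lemma crossings_graphs (R : realType) M (t : R) (x y : 'I_M -> R) :
  \bigcup_j ([set q : R * R | q.1 = t] `&` [set q | q.2 = x j + q.1 * y j]) =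
  range (fun j => (t, x j + t * y j)).
Proof.
apply/seteqP; split=> [[a b] [j _ [/= -> ->]]|q [j _ <-]].
  by exists j.
by exists j.
Qed.

(** * Points with arguments in arithmetic progression *)

Definition step (R : realType) (n : nat) : R := pi / n%:R.

Section Polar.
Variables (R : realType) (n : nat).
Hypothesis n_gt0 : (0 < n)%N.
Local Notation u := (step R n).

Lemma step_gt0 : 0 < u.
Proof. by rewrite divr_gt0 ?pi_gt0 ?ltr0n. Qed.

Lemma nstep : n%:R * u = pi.
Proof. by rewrite /step mulrC divfK // pnatr_eq0 -lt0n. Qed.

(** The common offset [a] is free because [polar_config] has to rotate all the
points by half a step. *)
Lemma polar_inj (r r' : R) (p p' : nat) (a : R) :
  (p < 2 * n)%N -> (p' < 2 * n)%N -> 0 <= r -> 0 <= r' ->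
  r * cos (p%:R * u + a) = r' * cos (p'%:R * u + a) ->
  r * sin (p%:R * u + a) = r' * sin (p'%:R * u + a) ->
  r = r' /\ (r = 0 \/ p = p').
Proof.
move=> pn pn' r0 r0' ec es.
have rr : r = r'.
  apply/eqP; rewrite -(@eqrXn2 _ 2) //; apply/eqP.
  have sq z b : z ^+ 2 = (z * cos b) ^+ 2 + (z * sin b) ^+ 2 :> R.
    by rewrite !exprMn -mulrDr cos2Dsin2 mulr1.
  by rewrite (sq r (p%:R * u + a)) ec es -sq.
split=> //; have [->|rn0] := eqVneq r 0; [by left|right].
move: ec es; rewrite -rr => /(mulfI rn0) ec /(mulfI rn0) es.
have : p%:R * u - p'%:R * u = 0.
  apply: cos_eq1_small.
    have := step_gt0; have := nstep.
    have : p%:R < 2 * n%:R :> R by rewrite -natrM ltr_nat.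
    have : p'%:R < 2 * n%:R :> R by rewrite -natrM ltr_nat.
    have : 0 <= p%:R :> R by []. have : 0 <= p'%:R :> R by [].
    move=> h1 h2 h3 h4 <- u0; rewrite -mulrBl normrM (gtr0_norm u0) mulrA.
    by rewrite ltr_pM2r // ltr_norml; lra.
  rewrite (_ : _ - _ = (p%:R * u + a) - (p'%:R * u + a)); last by ring.
  by rewrite cosB ec es -!expr2 cos2Dsin2.
move/eqP; rewrite subr_eq0 => /eqP /(mulIf (lt0r_neq0 step_gt0)) /eqP.
by rewrite eqr_nat => /eqP.
Qed.

(** A configuration of lines from points of polar coordinates (r j, p j u) and
directions s i u.  Everything is rotated so that the directions psi i lie
strictly between 0 and pi: then sin (psi i) is nonzero, the vertical line for
the direction psi i has abscissa - cot (psi i), and the crossing heights on it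
are the projections divided by sin (psi i). *)
Lemma polar_config L M (s : 'I_L -> nat) (r : 'I_M -> R) (p : 'I_M -> nat) :
  injective s -> (forall i, s i < n)%N ->
  (forall j, 0 <= r j) -> (forall j, p j < 2 * n)%N ->
  (forall j j', r j = r j' -> r j = 0 \/ p j = p j' -> j = j') ->
  exists (l : 'I_L -> set (R * R)) (lambda : 'I_M -> set (R * R)),
    lines_config l lambda /\
    forall i : 'I_L, (\bigcup_j (l i `&` lambda j) #=
      range (fun j => r j * cos ((p j)%:R * u - (s i)%:R * u)))%card.
Proof.
move=> sI sn r0 pn rp.
pose a := u / 2; pose psi i := (s i)%:R * u + a.
have u0 := step_gt0; have nu := nstep.
have psi_pi i : 0 < psi i < pi.
  have : (s i)%:R + 1 <= n%:R :> R by rewrite natr1 ler_nat.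
  have : 0 <= (s i)%:R :> R by [].
  by move=> h1 h2; rewrite -nu /psi /a; apply/andP; split; nra.
have sin0 i : 0 < sin (psi i) by exact: sin_gt0_pi.
pose t i := - cos (psi i) / sin (psi i).
pose x j := r j * sin ((p j)%:R * u + a).
pose y j := - (r j * cos ((p j)%:R * u + a)).
exists (fun i => [set q : R * R | q.1 = t i]),
       (fun j => [set q : R * R | q.2 = x j + q.1 * y j]); split.
  apply: lines_config_graphs => [i k|j k] /=; last first.
    case=> es /oppr_inj ec; have [e1 e2] := polar_inj (pn j) (pn k) (r0 j) (r0 k) ec es.
    exact: rp.
  rewrite /t => /eqP; rewrite eqr_div ?lt0r_neq0 // => /eqP e.
  have /sin_eq0_small : sin (psi i - psi k) = 0 by rewrite sinB; lra.
  have := psi_pi i; have := psi_pi k => h1 h2.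
  move=> H; have : psi i - psi k = 0 by apply: H; rewrite ltr_norml; lra.
  rewrite /psi opprD addrACA subrr addr0 => /eqP; rewrite subr_eq0.
  move=> /eqP /(mulIf (lt0r_neq0 u0)) /eqP; rewrite eqr_nat => /eqP; exact: sI.
move=> i; rewrite crossings_graphs.
have -> : (fun j => (t i, x j + t i * y j)) =
    (fun v => (t i, v / sin (psi i))) \o
    (fun j => r j * cos ((p j)%:R * u - (s i)%:R * u)).
  apply/funext => j /=; congr (_, _).
  rewrite (_ : _ - _ = ((p j)%:R * u + a) - psi i); last by rewrite /psi; ring.
  by rewrite cosB /x /y /t; field; rewrite gt_eqF.
rewrite -image_comp; apply: inj_card_eq => v w _ _ [] /mulIf; apply.
by rewrite invr_eq0 gt_eqF.
Qed.

(** The symmetries x |-> - x and x |-> 2 pi - x of cosine bring the angle back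
to [0, pi].  They preserve the parity of its multiple of u, since 2 pi = 2 n u. *)
Lemma cos_fold (p s : nat) : (p < 2 * n)%N -> (s < n)%N ->
  exists k, [/\ (k <= n)%N, odd k = odd (p + s) &
    cos (p%:R * u - s%:R * u) = cos (k%:R * u)].
Proof.
move=> pn sn; have nu := nstep.
have [ps|sp] := ltnP p s.
  exists (s - p)%N; split; [lia|lia|].
  by rewrite -cosN natrB ?(ltnW ps) //; congr cos; ring.
have [psn|psn] := leqP (p - s) n.
  by exists (p - s)%N; split; [lia|lia|rewrite natrB // mulrBl].
exists (2 * n - (p - s))%N; split; [lia|lia|].
rewrite natrB; last by lia.
rewrite natrM natrB // -cosN -[LHS]cosD2pi -nu mulr2n; congr cos; ring.
Qed.

Lemma cos_step_inj : {in [pred k | k <= n]%N &,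
  injective (fun k : nat => cos (k%:R * u))}.
Proof.
have u0 := step_gt0; have nu := nstep.
move=> j k; rewrite !inE => jn kn e.
have in0pi i : (i <= n)%N -> (i%:R * u) \in `[0, pi].
  by move=> ile; rewrite in_itv /= -nu mulr_ge0 ?ler_pM2r ?ler_nat ?(ltW u0).
have := cos_inj (in0pi _ jn) (in0pi _ kn) e.
by move/(mulIf (lt0r_neq0 u0))/eqP; rewrite eqr_nat => /eqP.
Qed.

End Polar.

(** * The regular polygon *)

Lemma regular_polygon_config (R : realType) N M :
  (0 < N)%N -> (M <= 2 * N + odd N)%N ->
  exists (l : 'I_N -> set (R * R)) (lambda : 'I_M -> set (R * R)),
    lines_config l lambda /\
    forall i : 'I_N, (\bigcup_j (l i `&` lambda j) #<= `I_N)%card.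
Proof.
move=> N0 MN; have n0 : (0 < 2 * N)%N by lia.
pose r (j : 'I_M) : R := if (j < 2 * N)%N then 1 else 0.
pose p (j : 'I_M) := if (j < 2 * N)%N then (2 * j)%N else 0%N.
have [||||j j'|l [lambda [cfg sec]]] :=
  @polar_config R _ n0 N M (fun i => (2 * i + 1)%N) r p.
- by move=> i k e; apply: val_inj => /=; lia.
- by move=> i; have := ltn_ord i; lia.
- by move=> j; rewrite /r; case: ifP.
- by move=> j; rewrite /p; case: ifP; lia.
- have := ltn_ord j; have := ltn_ord j'; rewrite /r /p => h h'.
  case: ifPn => jn; case: ifPn => jn' e1 e2.
  + by case: e2 => [/eqP|e2]; [rewrite oner_eq0|apply: val_inj => /=; lia].
  + by move/eqP: e1; rewrite oner_eq0.
  + by move/eqP: e1; rewrite eq_sym oner_eq0.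
  + by apply: val_inj => /=; move: h h' MN jn jn'; case: (odd N); lia.
exists l, lambda; split=> // i.
apply: (card_le_trans (B := (fun h : nat => cos ((2 * h + 1)%:R * step R (2 * N))) @` `I_N));
  last exact: card_image_le.
move: (sec i); rewrite card_eq_le => /andP[secl _].
apply: (card_le_trans secl); apply: subset_card_le => v [j _ <-].
rewrite /r /p; have jM := ltn_ord j; case: ifPn => jn; last first.
  have oN : odd N by move: MN jM jn; case: (odd N) => //; lia.
  (* The center: N./2 is the index of the odd number N, and cos (N u) = 0. *)
  exists N./2 => /=; first by lia.
  rewrite mul0r -[in RHS](cos_pihalf R); congr cos.
  rewrite (_ : 2 * N./2 + 1 = N)%N; last by lia.
  by have := nstep R n0; rewrite natrM => <-; field.
have [||k [kn ok ->]] := @cos_fold R _ n0 (2 * j)%N (2 * i + 1)%N.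
- lia.
- by have := ltn_ord i; lia.
exists k./2 => /=; first by lia.
by rewrite mul1r (_ : 2 * k./2 + 1 = k)%N //; lia.
Qed.

(** * Two regular polygons and their center *)

Section DoubleOrbit.
Variables (R : realType) (m : nat).
Hypothesis m_gt0 : (0 < m)%N.
Let n := (12 * m)%N.
Let c (k : nat) : R := cos (k%:R * step R n).
Let r : R := 2 * c (6 * m - 1).

Let n_gt0 : (0 < n)%N. Proof. by rewrite /n; lia. Qed.

Lemma c_pi2 : c (6 * m) = 0.
Proof.
rewrite -(cos_pihalf R); congr cos; have := nstep R n_gt0.
by rewrite /n !natrM => <-; field.
Qed.

Lemma c_pi3 : c (4 * m) = 2^-1.
Proof.
rewrite -(cos_pi3 R); congr cos; have := nstep R n_gt0.
by rewrite /n !natrM => <-; field.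
Qed.

Lemma c_compl k : (k <= n)%N -> c (n - k) = - c k.
Proof.
move=> kn; rewrite /c -[in RHS]cosN -[RHS]cosDpi natrB //; congr cos.
by rewrite -(nstep R n_gt0); ring.
Qed.

Lemma c_prod a b : (b <= a)%N -> 2 * c a * c b = c (a + b) + c (a - b).
Proof.
move=> ba; rewrite /c [(a + b)%:R]natrD [(a - b)%:R]natrB //.
by rewrite [X in cos X + _]mulrDl mulrBl cosD cosB; ring.
Qed.

Lemma c_lt j k : (j < k <= n)%N -> c k < c j.
Proof.
move=> /andP[jk kn]; have u0 := step_gt0 R n_gt0; have nu := nstep R n_gt0.
have in0pi i : (i <= n)%N -> (i%:R * step R n) \in `[0, pi].
  by move=> ile; rewrite in_itv /= -nu mulr_ge0 ?ler_pM2r ?ler_nat ?(ltW u0).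
by rewrite /c ltr_cos ?in0pi ?ltr_pM2r ?ltr_nat //; lia.
Qed.

Lemma c_le j k : (j <= k <= n)%N -> c k <= c j.
Proof.
move=> /andP[jk kn]; have [->//|jk'] := eqVneq j k.
by apply/ltW/c_lt; lia.
Qed.

Lemma c_inj j k : (j <= n)%N -> (k <= n)%N -> c j = c k -> j = k.
Proof. by move=> jn kn; apply: (@cos_step_inj R _ n_gt0). Qed.

Lemma r_gt0 : 0 < r.
Proof.
have : c (6 * m) < c (6 * m - 1) by apply: c_lt; rewrite /n; lia.
by rewrite c_pi2 /r; lra.
Qed.

Lemma r_c1 : r * c 1 = c (6 * m - 2).
Proof.
rewrite /r c_prod; last by lia.
have -> : (6 * m - 1 + 1 = 6 * m)%N by lia.
by rewrite c_pi2 add0r; congr c; lia.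
Qed.

Lemma r_c4m : r * c (4 * m) = c (6 * m - 1).
Proof. by rewrite c_pi3 /r; field. Qed.

(** This is 2 sin a < sin (3 a) for a = u, in the form
r cos (2 u) = c (6 m - 3) - c (6 m - 1) with cos (2 u) > 1 / 2. *)
Lemma r_lt : r < c (6 * m - 3).
Proof.
(* The term c (6 m + 1) is written with n - (6 m - 1) to get its opposite. *)
have := @c_prod (6 * m - 1) 2; have -> : (6 * m - 1 + 2 = n - (6 * m - 1))%N.
  by rewrite /n; lia.
have -> : (6 * m - 1 - 2 = 6 * m - 3)%N by lia.
rewrite c_compl -/r; last by rewrite /n; lia.
have : c (4 * m) < c 2 by apply: c_lt; rewrite /n; lia.
rewrite c_pi3 => c2 /(_ ltac:(lia)); have := r_gt0; rewrite /r => r0 e.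
have : r / 2 * c 2 > r / 2 * 2^-1 by rewrite ltr_pM2l // /r; lra.
by rewrite /r; lra.
Qed.

(** In the quadrant where the cosines are nonnegative.  If k is odd, then c k' is
at least c (6 m - 2) = r c 1, which is the maximum of r c over odd indices.  If
k is even, then either k' = 6 m - 1, so that c k = 1 / 2, or c k' is at least
c (6 m - 3), which exceeds r. *)
Lemma collision_upper k k' : (k <= 6 * m)%N -> (k' <= 6 * m)%N ->
  odd k != odd k' -> r * c k = c k' -> k = if odd k then 1%N else (4 * m)%N.
Proof.
move=> kn kn' okk e; have r0 := r_gt0.
have ck1 : c k <= 1 by exact: cos_le1.
case: ifPn => ok.
  have k'6 : k' != (6 * m)%N.
    apply/eqP => k'6; move: e; rewrite k'6 c_pi2 => /eqP.
    rewrite mulf_eq0 gt_eqF //= => /eqP e0.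
    by have := @c_inj k (6 * m); rewrite c_pi2 /n => /(_ _ _ e0); lia.
  have [//|k1] : k = 1%N \/ (1 < k)%N by lia.
  have : c k < c 1 by apply: c_lt; rewrite /n; lia.
  have : c (6 * m - 2) <= c k' by apply: c_le; rewrite /n; lia.
  by rewrite -r_c1 -e ler_pM2l // leNgt => /negP.
have [k'6|k'6] : k' = (6 * m - 1)%N \/ (k' <= 6 * m - 3)%N by lia.
  apply: c_inj; rewrite /n; [lia|lia|].
  by apply: (mulfI (lt0r_neq0 r0)); rewrite e k'6 r_c4m.
have : c (6 * m - 3) <= c k' by apply: c_le; rewrite /n; lia.
rewrite -e leNgt => /negP; case.
by apply: le_lt_trans r_lt; rewrite -[leRHS]mulr1 ler_pM2l.
Qed.

(** The index at which the short orbit repeats a positive value of the long one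
in the direction s u; n - k0 s is the one for the opposite value. *)
Let k0 (s : nat) := if odd s then (4 * m)%N else 1%N.

(** The sign of the common value puts k and k' on the same side of 6 m, and
k |-> n - k exchanges the two sides. *)
Lemma collision s k k' : (k <= n)%N -> (k' <= n)%N ->
  odd k != odd s -> odd k' = odd s -> r * c k = c k' ->
  k = k0 s \/ k = (n - k0 s)%N.
Proof.
rewrite /k0 /n => kn kn' oks oks' e; have r0 := r_gt0.
have okk : odd k != odd k' by rewrite oks'.
have [kl|kl] := leqP k (6 * m); have [kl'|kl'] := leqP k' (6 * m).
- left; rewrite (collision_upper kl kl' okk e); move: oks okk oks'.
  by case: (odd k) (odd k') (odd s) => [] [] [].
- have : 0 <= c k by rewrite -c_pi2; apply: c_le; rewrite /n; lia.
  have : c k' < 0 by rewrite -c_pi2; apply: c_lt; rewrite /n; lia.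
  by rewrite -e pmulr_rlt0 // ltNge => /negP.
- have : c k < 0 by rewrite -c_pi2; apply: c_lt; rewrite /n; lia.
  have : 0 <= c k' by rewrite -c_pi2; apply: c_le; rewrite /n; lia.
  by rewrite -e pmulr_rge0 // leNgt => /negP.
- right; have e' : r * c (n - k) = c (n - k').
    by rewrite !c_compl // mulrN e.
  have := @collision_upper (n - k) (n - k'); rewrite /n => H.
  have := H _ _ _ e'; have -> : odd (12 * m - k) = odd k by lia.
  have -> : odd (12 * m - k') = odd k' by lia.
  move=> /(_ ltac:(lia) ltac:(lia) okk).
  move: oks okk oks'; case: (odd k) (odd k') (odd s) => [] [] [] //; lia.
Qed.

(** In the direction s u the term cos (k u) comes from the point of argument
(k + s) u, whose parity tells the orbit. *)
Let radius (q : nat) : R := if odd q then r else 1.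
Let value (s k : nat) : R := radius (k + s) * c k.
Let indices s := rem (n - k0 s)%N (rem (k0 s) (iota 0 n.+1)).

Lemma mem_indices s k :
  (k \in indices s) = [&& (k <= n)%N, k != k0 s & k != (n - k0 s)%N].
Proof.
rewrite mem_rem_uniq ?rem_uniq ?iota_uniq // inE mem_rem_uniq ?iota_uniq //.
rewrite inE mem_iota leq0n add0n ltnS.
by case: (k <= n)%N; case: (k != k0 s); rewrite ?andbT ?andbF.
Qed.

Lemma k0_bounds s : (0 < k0 s < n - k0 s)%N.
Proof. by rewrite /k0 /n; case: ifP; lia. Qed.

Lemma size_indices s : size (indices s) = (n - 1)%N.
Proof.
have kb := k0_bounds s.
rewrite size_rem ?size_rem ?size_iota ?mem_iota; last 2 first.
- by lia.
- rewrite mem_rem_uniq ?iota_uniq // !inE mem_iota; lia.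
by rewrite /= subn1.
Qed.

Lemma value_inj s : {in indices s &, injective (value s)}.
Proof.
move=> j k; rewrite !mem_indices => /and3P[jn j1 j2] /and3P[kn k1 k2].
rewrite /value /radius; have r0 := lt0r_neq0 r_gt0.
case: ifPn => oj; case: ifPn => ok; rewrite ?mul1r.
- by move=> /(mulfI r0); exact: c_inj.
- by move=> e; case: (@collision s j k jn kn) => // [||/eqP|/eqP];
    rewrite ?(negbTE j1) ?(negbTE j2) //; lia.
- by move=> e; case: (@collision s k j kn jn) => // [||/eqP|/eqP];
    rewrite ?(negbTE k1) ?(negbTE k2) //; lia.
- exact: c_inj.
Qed.

(** The two omitted indices bring no new value: the long orbit takes it at
6 m - h and at 6 m + h. *)
Lemma value_covered s k : (k <= n)%N ->
  exists2 k', k' \in indices s & value s k' = value s k.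
Proof.
move=> kn; have kb := k0_bounds s.
have [kin|] := boolP (k \in indices s); first by exists k.
rewrite mem_indices kn /= negb_and !negbK.
pose h := if odd s then 1%N else 2%N.
have hE : r * c (k0 s) = c (6 * m - h).
  by rewrite /k0 /h; case: ifP => _; [exact: r_c4m|exact: r_c1].
have hval k' : (k' == 6 * m - h)%N || (k' == 6 * m + h)%N -> k' \in indices s /\ value s k' = c k'.
  rewrite mem_indices /value /radius /n /k0 /h.
  by case: ifPn => os /orP[] /eqP ->; (split; first by lia);
    case: ifPn => o; rewrite ?mul1r //; exfalso; lia.
have k0val k' : odd k' = odd (k0 s) -> value s k' = r * c k'.
  rewrite /value /radius /k0; case: (ifPn (odd s)) => os o;
  by case: ifPn => // o'; exfalso; lia.
have [|h1 h1'] := hval (6 * m - h)%N; first by rewrite eqxx.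
have [|h2 h2'] := hval (6 * m + h)%N; first by rewrite eqxx orbT.
case/orP => /eqP ->.
  by exists (6 * m - h)%N => //; rewrite h1' k0val // hE.
exists (6 * m + h)%N => //; rewrite h2' k0val; last by rewrite /n; lia.
rewrite c_compl; last by lia.
rewrite mulrN hE -c_compl /n; last by lia.
by congr c; rewrite /h; case: ifP; lia.
Qed.

(** The number L of directions is kept free: L = n is the case N = 12 m, and
L = n - 1 the case N = 12 m - 1. *)
Lemma double_orbit_config L : (L <= n)%N ->
  exists (l : 'I_L -> set (R * R)) (lambda : 'I_(2 * n + 1) -> set (R * R)),
    lines_config l lambda /\
    forall i : 'I_L, (\bigcup_j (l i `&` lambda j) #= `I_(n - 1))%card.
Proof.
move=> Ln; have r0 := r_gt0.
have r1 : r < 1 by apply: (lt_le_trans r_lt); exact: cos_le1.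
(* The last index, 2 n, stands for the center. *)
pose rho (j : 'I_(2 * n + 1)) : R := if (j < 2 * n)%N then radius j else 0.
pose p (j : 'I_(2 * n + 1)) := if (j < 2 * n)%N then j : nat else 0%N.
have rad_gt0 q : 0 < radius q by rewrite /radius; case: ifP.
have [||||j j'|l [lambda [cfg sec]]] :=
  @polar_config R n n_gt0 L _ (fun i => i : nat) rho p.
- exact: val_inj.
- by move=> i; exact: leq_trans (ltn_ord i) Ln.
- by move=> j; rewrite /rho; case: ifP => // _; exact: ltW.
- by move=> j; rewrite /p; case: ifP; lia.
- rewrite /rho /p; case: ifPn => jn; case: ifPn => jn' e1 e2.
  + by case: e2 => [/eqP|e2]; [rewrite gt_eqF|exact: val_inj].
  + by move/eqP: e1; rewrite gt_eqF.
  + by move/eqP: e1; rewrite lt_eqF.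
  + by apply: val_inj => /=; have := ltn_ord j; have := ltn_ord j'; lia.
exists l, lambda; split=> // i; apply: (card_eq_trans (sec i)).
have iN : (i < n)%N := leq_trans (ltn_ord i) Ln.
have -> : range (fun j => rho j * cos ((p j)%:R * step R n - i%:R * step R n)) =
    value i @` [set` indices i].
  apply/seteqP; split=> [v [j _ <-]|v [k /= kin <-]].
    have : exists2 k, (k <= n)%N &
        value i k = rho j * cos ((p j)%:R * step R n - i%:R * step R n).
      rewrite /rho /p; case: ifPn => jn.
        have [k [kn ok ->]] := cos_fold R n_gt0 jn iN.
        by exists k => //; rewrite /value /radius oddD ok oddD -addbA addbb addbF.
      by exists (6 * m)%N; [rewrite /n; lia|rewrite /value c_pi2 mulr0 mul0r].
    by move=> [k kn <-]; have [k' k'in e] := value_covered i kn; exists k'.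
  move: kin; rewrite mem_indices => /and3P[kn k1 k2].
  have kj : (k + i < 2 * n + 1)%N by lia.
  exists (Ordinal kj) => //; rewrite /rho /p /=.
  have -> : (k + i < 2 * n)%N by lia.
  by rewrite /value /c natrD mulrDl addrK.
rewrite -(size_indices i).
apply: (card_eq_trans _ (card_uniq_seq 0%N _)); last by rewrite !rem_uniq ?iota_uniq.
by apply: inj_card_eq => j k; rewrite !inE => jin kin; exact: value_inj.
Qed.

End DoubleOrbit.

(** * The theorem *)

Theorem mainTheorem2 (R : realType) :
  (forall N : nat, (5 <= N)%N ->
    exists (l : 'I_N -> set (R * R)) (lambda : 'I_(num_lines N) -> set (R * R)),
      lines_config l lambda /\
      forall i : 'I_N, (\bigcup_j (l i `&` lambda j) #<= `I_N)%card) /\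
  (forall N m : nat, (0 < m)%N -> N = (12 * m)%N ->
    exists (l : 'I_N -> set (R * R)) (lambda : 'I_(2 * N + 1) -> set (R * R)),
      lines_config l lambda /\
      forall i : 'I_N, (\bigcup_j (l i `&` lambda j) #= `I_(N - 1))%card).
Proof.
split=> [N N5|N m m0 ->]; last exact: double_orbit_config.
have weaken L M K : (K <= N)%N -> M = num_lines N -> L = N ->
    (exists (l : 'I_L -> set (R * R)) (lambda : 'I_M -> set (R * R)),
      lines_config l lambda /\
      forall i : 'I_L, (\bigcup_j (l i `&` lambda j) #= `I_K)%card) ->
    exists (l : 'I_N -> set (R * R)) (lambda : 'I_(num_lines N) -> set (R * R)),
      lines_config l lambda /\
      forall i : 'I_N, (\bigcup_j (l i `&` lambda j) #<= `I_N)%card.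
  move=> KN -> -> [l [lambda [cfg sec]]]; exists l, lambda; split=> // i.
  move: (sec i); rewrite card_eq_le => /andP[le _].
  by apply: (card_le_trans le); rewrite card_le_II.
have [N11|N11] := boolP (N.+1 == 0 %[mod 12]).
  have [m Nm] : exists m, N.+1 = (12 * m)%N by exists (N.+1 %/ 12)%N; lia.
  apply: (weaken N _ _ _ _ _ (@double_orbit_config R m _ N _)); try lia.
  by rewrite /num_lines N11; lia.
have [N0|N0] := eqVneq (N %% 12)%N 0%N.
  have [m Nm] : exists m, N = (12 * m)%N by exists (N %/ 12)%N; lia.
  apply: (weaken N _ _ _ _ _ (@double_orbit_config R m _ N _)); try lia.
  by rewrite /num_lines (negbTE N11) N0 /=; lia.
apply: regular_polygon_config; first by lia.
rewrite /num_lines (negbTE N11) !inE (negbTE N0) /=.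
case: ifPn => h; last by rewrite leq_addr.
have -> : odd N by lia.
by [].
Qed.
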